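(* Let $(X,\rho,\mathcal{S})$ be an unbounded complete separable hyperbolic space, let $(z_n)_{n=1}^\infty$ be a dense sequence in $X$ and let $\mathcal{M}$ be the set of all nonexpansive self-mappings of $X$, equipped with the metric \[ d_z(f,g)=\sum_{n=1}^\infty2^{-n}\frac{\rho(f(z_n),g(z_n))}{1+\rho(f(z_n),g(z_n))}. \] The set of Rakotch contractions on $X$ is meagre in $(\mathcal{M},d_z)$.
   Context: Hyperbolic spaces. A geodesic metric space is a metric space $(X,\rho)$ such that for all $x,y\in X$ there is an isometric embedding $c\colon[0,\rho(x,y)]\to X$ with $c(0)=x$, $c(\rho(x,y))=y$; the image of such a $c$ is a metric segment connecting $x$ and $y$. A hyperbolic space is a triple $(X,\rho,\mathcal{S})$ where $(X,\rho)$ is a geodesic metric space and $\mathcal{S}$ is a family of metric segments such that: (1) for each pair $x,y\in X$, $\mathcal{S}$ contains a unique metric segment connecting $x$ and $y$, denoted $[x,y]$; (2) for all $x,y\in X$ and $z,w\in[x,y]$ we have $[z,w]\subset[x,y]$; (3) $\rho((1-\lambda)x\oplus\lambda y,(1-\lambda)x\oplus\lambda z)\leq\lambda\rho(y,z)$ for all $x,y,z\in X$ and $\lambda\in[0,1]$, where $(1-\lambda)x\oplus\lambda y$ denotes the unique point of $[x,y]$ at distance $\lambda\rho(x,y)$ from $x$ and $(1-\lambda)\rho(x,y)$ from $y$. Mappings. A mapping $f\colon X\to X$ is nonexpansive if $\rho(f(x),f(y))\leq\rho(x,y)$ for all $x,y\in X$. A Rakotch contraction is a mapping $f\colon X\to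 X$ for which there is a (non-strictly) decreasing function $\varphi_f\colon[0,\infty)\to[0,1]$ with $\varphi_f(t)<1$ for $t>0$ such that $\rho(f(x),f(y))\leq\varphi_f(\rho(x,y))\rho(x,y)$ for all $x,y\in X$. *)

(* Defs.v *)
From HB Require Import structures.
From mathcomp Require Import all_boot all_order all_algebra.
From mathcomp Require Import ring lra.
From mathcomp Require Import all_classical all_reals all_analysis.

Set Implicit Arguments.
Unset Strict Implicit.
Unset Printing Implicit Defensive.

Import Order.TTheory GRing.Theory Num.Theory.
Import numFieldNormedType.Exports.

Local Open Scope classical_set_scope.
Local Open Scope ring_scope.

(* Completeness in the library includes a base point; this excludes only the
   empty space, which is bounded. *)
#[short(type="completeMetricType")]
HB.structure Definition CompleteMetric (K : numDomainType) :=
  {T of Complete T & Metric K T}.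

Definition separable (T : topologicalType) : Prop :=
  exists2 A : set T, countable A & dense A.

Definition nowhere_dense (T : topologicalType) (A : set T) : Prop :=
  interior (closure A) = set0.

Definition meagre (T : topologicalType) (A : set T) : Prop :=
  exists2 F : nat -> set T,
    (forall n, nowhere_dense (F n)) & A = \bigcup_n F n.

Section Hyperbolic.
Context {R : realType} {X : metricType R}.

Definition metric_bounded (A : set X) : Prop :=
  exists M : R, forall x y, A x -> A y -> mdist x y <= M.

Definition geodesic (x y : X) (c : R -> X) : Prop :=
  [/\ {in `[0, mdist x y] &, forall s t, mdist (c s) (c t) = `|s - t|},
      c 0 = x & c (mdist x y) = y].

Definition metric_segment (x y : X) (A : set X) : Prop :=
  exists2 c : R -> X, geodesic x y c & A = c @` `[0, mdist x y].

Definition geodesic_space : Prop := forall x y : X, exists c, geodesic x y c.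

(* The segment [x, y] of the family S, and the point (1 - l) x (+) l y on it;
   the defaults [set0] and [x] of [xget] are irrelevant when S is as in
   [hyperbolic]. *)
Definition segment (S : set (set X)) (x y : X) : set X :=
  xget set0 [set A | S A /\ metric_segment x y A].

Definition segment_point (S : set (set X)) (l : R) (x y : X) : X :=
  xget x [set p | [/\ segment S x y p, mdist x p = l * mdist x y
                    & mdist p y = (1 - l) * mdist x y]].

Record hyperbolic (S : set (set X)) : Prop := {
  hyperbolic_geodesic : geodesic_space;
  hyperbolic_segments : forall A, S A -> exists x y, metric_segment x y A;
  hyperbolic_unique : forall x y, exists! A, S A /\ metric_segment x y A;
  hyperbolic_sub : forall x y z w,
    segment S x y z -> segment S x y w -> segment S z w `<=` segment S x y;
  hyperbolic_convex : forall x y z l, 0 <= l <= 1 ->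
    mdist (segment_point S l x y) (segment_point S l x z) <= l * mdist y z
}.

Definition nonexpansive (f : X -> X) : Prop :=
  forall x y, mdist (f x) (f y) <= mdist x y.

Definition rakotch_contraction (f : X -> X) : Prop :=
  exists phi : R -> R,
    [/\ forall t, 0 <= t -> 0 <= phi t <= 1,
        forall s t, 0 <= s -> s <= t -> phi t <= phi s,
        forall t, 0 < t -> phi t < 1
      & forall x y, mdist (f x) (f y) <= phi (mdist x y) * mdist x y].

End Hyperbolic.

Arguments geodesic_space {R} X.

(* The set of nonexpansive self-mappings of X. The sequence z and its density
   are parameters because the metric below depends on z and is definite only
   when z is dense. *)
Record nonexpansive_maps (R : realType) (X : metricType R) (z : nat -> X)
    (z_dense : dense (range z)) := NonexpansiveMap {
  nonexpansive_fun :> X -> X;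
  nonexpansiveP : nonexpansive nonexpansive_fun
}.

Section NonexpansiveMetric.
Context {R : realType} {X : metricType R} (z : nat -> X).

(* The index is shifted: z n is the (n+1)-st term of the sequence, whence the
   weight 2^-(n+1). *)
Definition dz_term (f g : X -> X) (n : nat) : R :=
  2 ^- n.+1 * (mdist (f (z n)) (g (z n)) / (1 + mdist (f (z n)) (g (z n)))).

Definition dz (f g : X -> X) : R := limn (series (dz_term f g)).

Let frac_ge0 (a : R) : 0 <= a -> 0 <= a / (1 + a).
Proof. by move=> a0; rewrite divr_ge0// addr_ge0. Qed.

Let frac_le1 (a : R) : 0 <= a -> a / (1 + a) <= 1.
Proof. by move=> a0; rewrite ler_pdivrMr; lra. Qed.

Let frac_triangle (a b c : R) : 0 <= a -> 0 <= b -> 0 <= c -> a <= b + c ->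
  a / (1 + a) <= b / (1 + b) + c / (1 + c).
Proof.
move=> a0 b0 c0 abc.
have E (t : R) : 0 <= t -> t / (1 + t) = 1 - (1 + t)^-1.
  by move=> t0; field; rewrite gt_eqF// ltr_wpDr.
apply: (@le_trans _ _ ((b + c) / (1 + (b + c)))).
  rewrite !E ?addr_ge0// lerB// lef_pV2 ?posrE; lra.
rewrite mulrDl lerD// ler_wpM2l// lef_pV2 ?posrE; lra.
Qed.

Lemma dz_term_ge0 f g n : 0 <= dz_term f g n.
Proof. by rewrite mulr_ge0// ?frac_ge0 ?mdist_ge0// invr_ge0 exprn_ge0. Qed.

Lemma dz_term_le f g n : dz_term f g n <= geometric 2^-1 2^-1 n.
Proof.
rewrite /geometric /= -exprS exprVn -[leRHS]mulr1.
by apply: ler_wpM2l; rewrite ?invr_ge0 ?exprn_ge0// frac_le1 ?mdist_ge0.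
Qed.

Lemma is_cvg_dz f g : cvgn (series (dz_term f g)).
Proof.
apply: (@series_le_cvg _ _ (geometric 2^-1 2^-1)).
- exact: dz_term_ge0.
- by move=> n; rewrite (le_trans (dz_term_ge0 f g n) (dz_term_le f g n)).
- exact: dz_term_le.
- by apply: is_cvg_geometric_series; rewrite ger0_norm; lra.
Qed.

Lemma dz_term_le_dz f g n : dz_term f g n <= dz f g.
Proof.
apply: (@le_trans _ _ (series (dz_term f g) n.+1)).
  rewrite /series /= big_nat_recr//= lerDr sumr_ge0// => i _.
  exact: dz_term_ge0.
apply: nondecreasing_cvgn_le; last exact: is_cvg_dz.
by apply/nondecreasing_seqP => k; rewrite /series /= big_nat_recr//= lerDl dz_term_ge0.
Qed.

Lemma dzxx f : dz f f = 0.
Proof.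
rewrite /dz (_ : series _ = cst 0) ?lim_cst//.
by apply/funext => n; rewrite /series /= big1// => i _;
  rewrite /dz_term mdistxx mul0r mulr0.
Qed.

Lemma dz_sym f g : dz f g = dz g f.
Proof.
rewrite /dz (_ : dz_term f g = dz_term g f)//.
by apply/funext => n; rewrite /dz_term metric_sym.
Qed.

Lemma dz_triangle g f h : dz f h <= dz f g + dz g h.
Proof.
rewrite /dz -lim_seriesD; [|exact: is_cvg_dz..].
apply: lim_series_le.
- exact: is_cvg_dz.
- by apply: is_cvg_seriesD; exact: is_cvg_dz.
move=> n; rewrite [leRHS]/= -mulrDr ler_wpM2l ?invr_ge0 ?exprn_ge0//.
by rewrite frac_triangle ?mdist_ge0 ?metric_triangle.
Qed.

Lemma dz_eq0 (z_dense : dense (range z)) (f g : nonexpansive_maps z_dense) :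
  dz f g = 0 -> f = g.
Proof.
move=> dfg.
have fgz n : f (z n) = g (z n).
  apply: mdist_positivity; apply/eqP.
  have := dz_term_le_dz f g n; rewrite dfg => le0.
  have /eqP : dz_term f g n = 0 by apply/le_anti; rewrite le0 dz_term_ge0.
  rewrite /dz_term !mulf_eq0 invr_eq0 expf_eq0 /= pnatr_eq0 /= invr_eq0.
  by rewrite [X in _ || X]gt_eqF ?orbF// ltr_wpDr ?mdist_ge0.
have fg : f = g :> (X -> X).
  apply/funext => x; apply: mdist_positivity; apply/le_anti.
  rewrite mdist_ge0 andbT; apply/ler_addgt0Pl => e e0; rewrite addr0.
  have e20 : 0 < e / 2 by lra.
  have [||y [xy [n _ ny]]] := z_dense (interior (ball x (e / 2))).
  - by exists x; exact: nbhsx_ballx.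
  - exact: open_interior.
  have {}xy := interior_subset xy; rewrite ballEmdist/= in xy.
  rewrite -ny in xy.
  have := metric_triangle (f x) (f (z n)) (g x).
  have := nonexpansiveP f x (z n); have := nonexpansiveP g (z n) x.
  rewrite (metric_sym (z n) x) fgz; lra.
case: f g fg {dfg fgz} => [f Pf] [g Pg] /= fg.
by rewrite fg in Pf *; congr NonexpansiveMap; exact: Prop_irrelevance.
Qed.

End NonexpansiveMetric.

Section Instances.
Context {R : realType} {X : metricType R} {z : nat -> X}.
Context {z_dense : dense (range z)}.
Local Notation M := (nonexpansive_maps z_dense).

HB.instance Definition _ := gen_eqMixin M.
HB.instance Definition _ := gen_choiceMixin M.
HB.instance Definition _ := @isMetric.Build R M (fun f g => dz z f g)
  (fun f => dzxx z f) (@dz_eq0 _ _ z z_dense)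
  (fun f g => dz_sym z f g) (fun g f h => dz_triangle z g f h).

End Instances.

(* Main.v *)
(* A Rakotch contraction shrinks all distances at least 1 by a uniform factor
   1 - 1/(n+1), so it suffices that the maps with this property are nowhere dense
   for each n. Given a nonexpansive f and x0 in X, let g_r move f(x) towards f(x0)
   by the fraction s/r of their distance when s = d(x0, x) <= r, and follow a
   geodesic issuing from f(x0), at parameter min(s - r, 1), when s > r. The inner
   part is nonexpansive because d(f(x), f(x0)) <= s, so that the loss from varying
   the fraction is compensated by the contraction factor 1 - s/r. As r tends to
   infinity g_r converges pointwise to f, but g_r preserves the distance of a pair
   at distances r and r + 1 from x0 on a long geodesic from x0, and so does,
   approximately, every map close to g_r. *)

Require Import Defs.
From mathcomp Require Import all_boot all_order all_algebra.
From mathcomp Require Import ring lra.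
From mathcomp Require Import all_classical all_reals all_analysis.

Import Order.TTheory GRing.Theory Num.Theory.

Local Open Scope classical_set_scope.
Local Open Scope ring_scope.

(** * Segments and the points dividing them *)

Lemma segmentP {R : realType} {X : metricType R} (S : set (set X)) (x y : X) :
  hyperbolic S -> metric_segment x y (segment S x y).
Proof.
move=> hS; have [A [SA _]] := hyperbolic_unique hS x y.
by have [] : [set A | S A /\ metric_segment x y A] (segment S x y)
  by apply: xgetI SA.
Qed.

(** The default of [xget] never occurs: the value at [l * mdist x y] of a geodesic parametrizing the
    segment meets all three conditions. *)
Lemma segment_pointP {R : realType} {X : metricType R} (S : set (set X))
    (l : R) (x y : X) : hyperbolic S -> 0 <= l <= 1 ->
  [/\ segment S x y (segment_point S l x y),
      mdist x (segment_point S l x y) = l * mdist x y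
    & mdist (segment_point S l x y) y = (1 - l) * mdist x y].
Proof.
move=> hS /andP[l0 l1]; have [c [ciso c0 cd] defA] := segmentP S x y hS.
have d0 := mdist_ge0 x y.
have ld : l * mdist x y \in `[0, mdist x y].
  by rewrite in_itv /= mulr_ge0//= ler_piMl.
have in0 : 0 \in `[0, mdist x y] by rewrite in_itv /= lexx.
have ind : mdist x y \in `[0, mdist x y] by rewrite in_itv /= lexx andbT.
suff : [set p | [/\ segment S x y p, mdist x p = l * mdist x y
                  & mdist p y = (1 - l) * mdist x y]] (segment_point S l x y) by [].
apply: (@xgetI _ _ _ (c (l * mdist x y))); split.
- by rewrite defA; exists (l * mdist x y).
- by rewrite -{1}c0 ciso// sub0r normrN ger0_norm// mulr_ge0.
- rewrite -{2}cd ciso// distrC ger0_norm; first by ring.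
  by rewrite subr_ge0 ler_piMl.
Qed.

(** Both points lie on one geodesic from [x], where the distance to [x] determines the parameter. *)
Lemma mdist_segment_point {R : realType} {X : metricType R} (S : set (set X))
    (l m : R) (x y : X) : hyperbolic S -> 0 <= l <= 1 -> 0 <= m <= 1 ->
  mdist (segment_point S l x y) (segment_point S m x y) = `|l - m| * mdist x y.
Proof.
move=> hS l01 m01; have [c [ciso c0 _] defA] := segmentP S x y hS.
have d0 := mdist_ge0 x y.
have in0 : 0 \in `[0, mdist x y] by rewrite in_itv /= lexx.
have P (k : R) : 0 <= k <= 1 -> exists2 t, t \in `[0, mdist x y] &
    segment_point S k x y = c t /\ t = k * mdist x y.
  move=> k01; have [+ dk _] := segment_pointP S k x y hS k01.
  rewrite [in X in X -> _]defA => -[t tin ct]; exists t => //; split=> //.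
  rewrite -dk -ct -{1}c0 ciso// sub0r normrN ger0_norm//.
  by move: tin; rewrite /= in_itv /= => /andP[].
have [s sin [-> sE]] := P l l01; have [t tin [-> tE]] := P m m01.
by rewrite ciso// sE tE -mulrBl normrM (ger0_norm d0).
Qed.

Lemma unbounded_far {R : realType} {X : metricType R} (x : X) (r : R) :
  ~ metric_bounded [set: X] -> exists w, r < mdist x w.
Proof.
move=> unb; apply: contrapT => /forallNP h; apply: unb; exists (r + r) => a b _ _.
have /negP := h a; have /negP := h b; rewrite -!leNgt => xb xa.
have := metric_triangle a x b; rewrite (metric_sym a x); lra.
Qed.

(** * The metric [dz] and pointwise distances *)

(** Some [z n] lies within [e / 3] of [x]. The [n]-th term of the series alone controls the distance
    at [z n], and nonexpansiveness of both maps carries the bound over to [x]. *)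
Lemma dz_lt_mdist_lt {R : realType} {X : metricType R} {z : nat -> X}
    (z_dense : dense (range z)) (x : X) (e : R) : 0 < e ->
  exists2 d : R, 0 < d & forall f g : X -> X, nonexpansive f -> nonexpansive g ->
    dz z f g < d -> mdist (f x) (g x) < e.
Proof.
move=> e0; pose r := e / 3; have r0 : 0 < r by rewrite /r; lra.
have [||y [+ [n _ ny]]] := z_dense (interior (ball x r)).
- by exists x; exact: nbhsx_ballx.
- exact: open_interior.
move=> /interior_subset; rewrite ballEmdist /= -ny => xz.
have w0 : 0 < 2 ^- n.+1 :> R by rewrite invr_gt0 exprn_gt0.
exists (2 ^- n.+1 * (r / (1 + r))); first by rewrite mulr_gt0// divr_gt0//; lra.
move=> f g nf ng /(le_lt_trans (dz_term_le_dz z f g n)).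
rewrite /dz_term ltr_pM2l//; have := mdist_ge0 (f (z n)) (g (z n)).
set a := mdist _ _ => a0; rewrite ltr_pdivrMr ?ltr_pdivlMr; [|lra..] => h.
(* The function t / (1 + t) is increasing. *)
have ar : a < r.
  move: h; rewrite mulrAC ltr_pdivlMr; last lra.
  nra.
have := metric_triangle (f x) (f (z n)) (g x).
have := metric_triangle (f (z n)) (g (z n)) (g x).
have := nf x (z n); have := ng (z n) x.
rewrite (metric_sym (z n) x) -/a /r in xz ar *; lra.
Qed.

(** The first [N] weights sum to less than 1 and the remaining ones to [2 ^- N], each multiplying a
    fraction at most 1. *)
Lemma dz_le {R : realType} {X : metricType R} (z : nat -> X) (f g : X -> X)
    (N : nat) (e : R) :
  (forall i, (i < N)%N -> mdist (f (z i)) (g (z i)) <= e) -> 0 <= e ->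
  dz z f g <= e + 2 ^- N.
Proof.
move=> fg e0.
have geom (n : nat) : 2 ^- n.+1 = 2 ^- n / 2 :> R.
  by rewrite exprSr invfM.
have pos (n : nat) : 0 < 2 ^- n :> R by rewrite invr_gt0 exprn_gt0.
have head (n : nat) : (n <= N)%N -> series (dz_term z f g) n <= e * (1 - 2 ^- n).
  elim: n => [_|n IH nN].
    by rewrite /series /= big_nil expr0 invr1 subrr mulr0.
  have := IH (ltnW nN); rewrite /series /= big_nat_recr//=.
  suff : dz_term z f g n <= 2 ^- n.+1 * e.
    by rewrite geom; lra.
  rewrite /dz_term ler_wpM2l ?(ltW (pos _))// (le_trans _ (fg n nN))//.
  have := mdist_ge0 (f (z n)) (g (z n)) => a0.
  by rewrite ler_pdivrMr; nra.
(* The subtracted power, which is dropped in the limit, makes the induction close. *)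
have tail (m : nat) : series (dz_term z f g) (N + m)%N <= e + 2 ^- N - 2 ^- (N + m).
  elim: m => [|m IH].
    rewrite addn0 (le_trans (head N (leqnn _)))//.
    have := pos N; nra.
  move: IH; rewrite /series /= addnS big_nat_recr//=.
  have := dz_term_le z f g (N + m)%N.
  rewrite /geometric /= -exprS exprVn geom; lra.
apply: limr_le; first exact: is_cvg_dz.
exists N => // n /= Nn; have := tail (n - N)%N; rewrite subnKC//.
have := pos n; lra.
Qed.

(** * The modified map *)

(* Both branches agree on the sphere of radius [r] around [x0], where they take
   the value [f x0]. *)
Definition radial_modification {R : realType} {X : metricType R}
    (S : set (set X)) (f : X -> X) (x0 : X) (r : R) (c : R -> X) (x : X) : X :=
  if mdist x0 x <= r
  then segment_point S (1 - mdist x0 x / r) (f x0) (f x)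
  else c (Num.min (mdist x0 x - r) 1).

Section RadialModification.
Context {R : realType} {X : metricType R} {S : set (set X)} (hS : hyperbolic S).
Context {f : X -> X} (nf : nonexpansive f) (x0 : X) {r : R} (r0 : 0 < r).
Context {w : X} {c : R -> X} (geo : geodesic (f x0) w c).
Context (w_far : 1 <= mdist (f x0) w).
Local Notation g := (radial_modification S f x0 r c).

Let coef01 x : mdist x0 x <= r -> 0 <= 1 - mdist x0 x / r <= 1.
Proof.
move=> xr; have : 0 <= mdist x0 x / r by rewrite divr_ge0 ?mdist_ge0 ?ltW.
have : mdist x0 x / r <= 1 by rewrite ler_pdivrMr ?mul1r.
lra.
Qed.

Let mdist_c (s t : R) : 0 <= s <= 1 -> 0 <= t <= 1 -> mdist (c s) (c t) = `|s - t|.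
Proof.
move=> /andP[s0 s1] /andP[t0 t1]; have [ciso _ _] := geo.
by rewrite ciso// in_itv /= ?s0 ?t0 (le_trans _ w_far).
Qed.

Let mdist_c0 (t : R) : 0 <= t <= 1 -> mdist (f x0) (c t) = t.
Proof.
move=> t01; have [_ <- _] := geo.
by rewrite mdist_c ?lexx ?ler01// sub0r normrN ger0_norm//; lra.
Qed.

Let min01 (t : R) : 0 <= t -> 0 <= Num.min t 1 <= 1.
Proof. by move=> t0; rewrite le_min t0 ler01 ge_min lexx orbT. Qed.

Lemma mdist_radial_modification x : mdist x0 x <= r ->
  mdist (f x) (g x) <= mdist x0 x ^+ 2 / r.
Proof.
move=> xr; rewrite /radial_modification xr.
have [_ _] := segment_pointP S _ (f x0) (f x) hS (coef01 x xr).
rewrite metric_sym => ->; rewrite subKr expr2 [leRHS]mulrAC ler_wpM2l ?nf//.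
by rewrite divr_ge0 ?mdist_ge0// ltW.
Qed.

Let inner_le x y : mdist x0 x <= mdist x0 y -> mdist x0 y <= r ->
  mdist (g x) (g y) <= mdist x y.
Proof.
move=> xy yr; have xr := le_trans xy yr.
rewrite /radial_modification xr yr.
set s := mdist x0 x in xy xr *; set t := mdist x0 y in xy yr *.
have s0 : 0 <= s := mdist_ge0 _ _.
have ts : t - s <= mdist x y.
  by have := metric_triangle x0 x y; rewrite -/s -/t; lra.
(* The intermediate point has the fraction belonging to [y] but lies on the segment to [f x]: the
   first distance is measured along one segment, the second is bounded by convexity. *)
apply: le_trans (metric_triangle _ (segment_point S (1 - t / r) (f x0) (f x)) _) _.
rewrite mdist_segment_point ?coef01//.
have := hyperbolic_convex hS (f x0) (f x) (f y) (coef01 y yr); rewrite -/t => conv.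
apply: le_trans (lerD (lexx _) conv) _.
have -> : 1 - s / r - (1 - t / r) = (t - s) / r by ring.
rewrite ger0_norm ?divr_ge0 ?subr_ge0// ?(ltW r0)//.
have ct : 0 <= 1 - t / r by have := coef01 y yr; rewrite -/t; lra.
apply: (@le_trans _ _ ((t - s) / r * s + (1 - t / r) * mdist x y)).
  rewrite lerD// ler_wpM2l ?nf//.
  by rewrite divr_ge0 ?subr_ge0// ltW.
(* It remains to see that (t - s) s <= t d(x, y), which follows from t - s <= d(x, y) and s <= t. *)
have -> : (t - s) / r * s + (1 - t / r) * mdist x y =
    mdist x y - (t * mdist x y - (t - s) * s) / r by ring.
rewrite lerBlDr lerDl divr_ge0 ?(ltW r0)// subr_ge0.
by rewrite [leLHS]mulrC; apply: ler_pM => //; lra.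
Qed.

Let mixed_le x y : mdist x0 x <= r -> r < mdist x0 y ->
  mdist (g x) (g y) <= mdist x y.
Proof.
move=> xr ry; rewrite /radial_modification xr [mdist x0 y <= r]leNgt ry /=.
set s := mdist x0 x in xr *; set t := mdist x0 y in ry *.
have s0 : 0 <= s := mdist_ge0 _ _.
have ts : t - s <= mdist x y.
  by have := metric_triangle x0 x y; rewrite -/s -/t; lra.
(* Passing through [f x0] costs at most r - s inside the ball and t - r outside, together t - s. *)
apply: le_trans (metric_triangle _ (f x0) _) (le_trans _ ts).
have tr : 0 <= t - r by lra.
rewrite mdist_c0 ?min01// metric_sym.
have [_ -> _] := segment_pointP S _ (f x0) (f x) hS (coef01 x xr); rewrite -/s.
have : (1 - s / r) * mdist (f x0) (f x) <= (1 - s / r) * r.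
  rewrite ler_wpM2l ?(le_trans (nf _ _))//.
  by have := coef01 x xr; rewrite -/s; lra.
have -> : (1 - s / r) * r = r - s by field; rewrite gt_eqF.
have : Num.min (t - r) 1 <= t - r by rewrite ge_min lexx.
lra.
Qed.

Let outer_le x y : r < mdist x0 x -> mdist x0 x <= mdist x0 y ->
  mdist (g x) (g y) <= mdist x y.
Proof.
move=> rx xy; have ry := lt_le_trans rx xy.
rewrite /radial_modification [mdist x0 x <= r]leNgt [mdist x0 y <= r]leNgt rx ry /= mdist_c ?min01; [|lra..].
have := metric_triangle x0 x y.
move: (mdist x0 x) (mdist x0 y) rx xy {ry} => s t rs st ts.
by rewrite ler_norml !minElt; case: ifP; case: ifP; lra.
Qed.

Lemma nonexpansive_radial_modification : nonexpansive g.
Proof.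
suff wlog_le x y : mdist x0 x <= mdist x0 y -> mdist (g x) (g y) <= mdist x y.
  move=> x y; have [/wlog_le//|/ltW/wlog_le] := leP (mdist x0 x) (mdist x0 y).
  by rewrite metric_sym (metric_sym y).
move=> xy; have [rx|xr] := ltP r (mdist x0 x); first exact: outer_le.
by have [ry|yr] := ltP r (mdist x0 y); [exact: mixed_le|exact: inner_le].
Qed.

(** On the sphere the fraction is 0, so [g x] is [f x0], the start of [c]; [g y] is [c 1]. *)
Lemma radial_modification_isometric_pair x y :
  mdist x0 x = r -> mdist x0 y = r + 1 -> mdist (g x) (g y) = 1.
Proof.
move=> xr yr; rewrite /radial_modification xr yr lexx leNgt ltrDl ltr01 /=.
rewrite divff ?gt_eqF// subrr addrAC subrr add0r minxx.
have [|_ + _] := segment_pointP S 0 (f x0) (f x) hS; first by rewrite lexx ler01.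
rewrite mul0r => /mdist_positivity <-.
by rewrite mdist_c0// ler01 lexx.
Qed.

End RadialModification.

Lemma geodesic_space_annulus {R : realType} {X : metricType R} (x0 : X) (r : R) :
  geodesic_space X -> ~ metric_bounded [set: X] -> 0 <= r ->
  exists x y, [/\ mdist x0 x = r, mdist x0 y = r + 1 & mdist x y = 1].
Proof.
move=> geoX unb r0; have [w wfar] := unbounded_far x0 (r + 1) unb.
have [c [ciso c0 _]] := geoX x0 w; exists (c r), (c (r + 1)).
have [in0 inr inr1] : [/\ 0 \in `[0, mdist x0 w], r \in `[0, mdist x0 w]
    & r + 1 \in `[0, mdist x0 w]] by rewrite !in_itv /=; split; lra.
rewrite -{1 2}c0 !ciso//; split; rewrite distrC ger0_norm; lra.
Qed.

(** * Category argument *)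

Definition contracts_large {R : realType} {X : metricType R} (n : nat)
    (f : X -> X) : Prop :=
  forall x y, 1 <= mdist x y -> mdist (f x) (f y) <= (1 - n.+1%:R^-1) * mdist x y.

Lemma rakotch_contracts_large {R : realType} {X : metricType R} (f : X -> X) :
  rakotch_contraction f -> exists n, contracts_large n f.
Proof.
move=> [phi [phi01 phi_noninc phi_lt1 fphi]].
have p1 : 0 < 1 - phi 1 by rewrite subr_gt0 phi_lt1.
(* With this n, 1 / (1 - phi 1) < n + 1, so phi 1 <= 1 - 1/(n+1); monotonicity extends the bound to
   all distances at least 1. *)
exists (Num.truncn (1 - phi 1)^-1) => x y xy; apply: le_trans (fphi x y) _.
rewrite ler_wpM2r ?mdist_ge0// (le_trans (phi_noninc 1 _ ler01 xy))//.
rewrite lerBrDr addrC -lerBrDr.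
rewrite invf_ple ?posrE ?ltr0n//; apply/ltW; exact: truncnS_gt.
Qed.

Lemma contracts_large_nowhere_dense {R : realType} {X : metricType R}
    {S : set (set X)} {z : nat -> X} (z_dense : dense (range z)) (n : nat) :
  hyperbolic S -> ~ metric_bounded [set: X] ->
  nowhere_dense [set f : nonexpansive_maps z_dense | contracts_large n f].
Proof.
move=> hS unb; rewrite /nowhere_dense -subset0 => f.
rewrite /interior /= -nbhs_ballE => -[e /= e0 fe].
have [N Ne] : exists N : nat, 2 ^- N < e / 2.
  exists (Num.truncn (e / 2)^-1).+1.
  rewrite invf_plt ?posrE ?exprn_gt0 ?divr_gt0//.
  apply: lt_trans (truncnS_gt _) _.
  by rewrite -natrX ltr_nat ltn_expl.
pose x0 := z 0%N.
pose B := \sum_(i < N) mdist x0 (z i).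
have B0 : 0 <= B by apply: sumr_ge0 => i _; exact: mdist_ge0.
have zB i : (i < N)%N -> mdist x0 (z i) <= B.
  move=> iN; rewrite /B (bigD1 (Ordinal iN))//= lerDl.
  by apply: sumr_ge0 => j _; exact: mdist_ge0.
(* This gives r > 0, puts the first [N] points within distance r of [x0], and makes their
   displacement, at most B^2 / r, no larger than e / 2. *)
pose r := 1 + B + B ^+ 2 / (e / 2).
have B2 : 0 <= B ^+ 2 / (e / 2) by rewrite divr_ge0 ?exprn_ge0//; lra.
have r0 : 0 < r by rewrite /r; lra.
have [w /ltW wfar] := unbounded_far (f x0) 1 unb.
have [c geo] := hyperbolic_geodesic hS (f x0) w.
have nf := nonexpansiveP f.
pose g : nonexpansive_maps z_dense :=
  NonexpansiveMap z_dense (nonexpansive_radial_modification hS nf x0 r0 geo wfar).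
have [x [y [xr yr xy1]]] :=
  geodesic_space_annulus x0 r (hyperbolic_geodesic hS) unb (ltW r0).
have gxy : mdist (g x) (g y) = 1.
  exact: (radial_modification_isometric_pair hS x0 r0 geo wfar).
have fg : ball f e g.
  rewrite ballEmdist /=; apply: (@le_lt_trans _ _ (e / 2 + 2 ^- N)); last lra.
  apply: dz_le; last lra.
  move=> i iN; have zBi := zB i iN; have zi0 := mdist_ge0 x0 (z i).
  apply: le_trans (mdist_radial_modification hS nf x0 r0 _ _) _.
    by rewrite /r; lra.
  rewrite ler_pdivrMr// (le_trans (lerXn2r _ _ _ zBi)) ?nnegrE//.
  have -> : B ^+ 2 = (e / 2) * (B ^+ 2 / (e / 2)) by field; rewrite gt_eqF.
  by rewrite ler_wpM2l /r//; lra.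
(* As [g] lies in the closure, some [h] in the set is within k/3 of it at both [x] and [y]. Then 1 =
   d(g x, g y) < k/3 + (1 - k) + k/3, which is absurd. *)
pose k : R := n.+1%:R^-1; have k0 : 0 < k by rewrite invr_gt0 ltr0n.
have k3 : 0 < k / 3 by rewrite divr_gt0.
have [dx dx0 dxP] := dz_lt_mdist_lt z_dense x _ k3.
have [dy dy0 dyP] := dz_lt_mdist_lt z_dense y _ k3.
have d0 : 0 < Num.min dx dy by rewrite lt_min dx0.
have [h [/= hn]] := fe g fg _ (nbhsx_ballx g _ d0).
rewrite ballEmdist /= lt_min => /andP[gx gy].
have {}gx := dxP g h (nonexpansiveP g) (nonexpansiveP h) gx.
have {}gy := dyP g h (nonexpansiveP g) (nonexpansiveP h) gy.
have := hn x y; rewrite xy1 lexx mulr1 -/k => /(_ isT).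
have := metric_triangle (g x) (h x) (g y).
have := metric_triangle (h x) (h y) (g y).
rewrite (metric_sym (h y)) gxy; lra.
Qed.

Lemma nowhere_denseS {T : topologicalType} (A B : set T) :
  A `<=` B -> nowhere_dense B -> nowhere_dense A.
Proof.
move=> AB; rewrite /nowhere_dense -!subset0; apply: subset_trans.
exact/interiorS/closureS.
Qed.

Theorem corollary6p11 (R : realType) (X : completeMetricType R)
    (S : set (set X)) (hypX : hyperbolic S)
    (unbX : ~ metric_bounded [set: X]) (sepX : separable X)
    (z : nat -> X) (z_dense : dense (range z)) :
  meagre [set f : nonexpansive_maps z_dense | rakotch_contraction f].
Proof.
(* Intersecting with the Rakotch contractions makes the union equal to their set, as [meagre]
   demands, rather than merely contain it. *)
exists (fun n => [set f : nonexpansive_maps z_dense |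
    rakotch_contraction f /\ contracts_large n f]).
  move=> n; apply: nowhere_denseS (contracts_large_nowhere_dense z_dense n hypX unbX).
  by move=> f [].
apply/seteqP; split=> [f rf|f [n _ []]//].
by have [n fn] := rakotch_contracts_large f rf; exists n.
Qed.
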